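(* For every finite field $\mathbb{K}$, the set $\mathcal{P}_2(\mathbb{K})$ of two-dimensional partial quasigroup rings over $\mathbb{K}$ is partitioned by the isotopism relation into exactly seven isotopism classes.
   Context: An algebra over $\mathbb{K}$ is a $\mathbb{K}$-vector space with a bilinear multiplication (not assumed associative, commutative or unital). Two algebras $A,A'$ over $\mathbb{K}$ are isotopic if there are three non-singular linear maps $f,g,h:A\to A'$ with $f(u)g(v)=h(uv)$ for all $u,v\in A$. A partial quasigroup of order $n$ is a pair $([n],\cdot)$, where $[n]=\{1,\ldots,n\}$ and $\cdot$ is a partial binary operation on $[n]$ (possibly nowhere defined) such that for all $i,j\in[n]$ each of the equations $i\cdot x=j$ and $y\cdot i=j$ has at most one solution in $[n]$; equivalently, its multiplication table is a partial Latin square (an $n\times n$ array whose cells are empty or contain an element of $[n]$, each symbol occurring at most once in each row and each column). The partial quasigroup ring over $\mathbb{K}$ based on $([n],\cdot)$ is the $n$-dimensional algebra with basis $\{e_1,\ldots,e_n\}$ and $e_ie_j=e_{i\cdot j}$ if $i\cdot j$ is defined, $e_ie_j=0$ otherwise. $\mathcal{P}_n(\mathbb{K})$ denotes the set of all $n$-dimensional partial quasigroup rings over $\mathbb{K}$ (arising from all partial quasigroups of order $n$). *)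

(* Defs.v *)
From HB Require Import structures.
From mathcomp Require Import all_boot all_order all_algebra.
From mathcomp Require Import sesquilinear.
From mathcomp Require Import boolp classical_sets functions cardinality.

Set Implicit Arguments.
Unset Strict Implicit.
Unset Printing Implicit Defensive.

Import GRing.Theory.

Local Open Scope ring_scope.
Local Open Scope classical_set_scope.

(* An algebra is a vector space V with a bilinear product V -> V -> V. It is
   represented by this product, with V left as a parameter: bundling V would
   put algebras in a universe too large for [set]. *)
Notation algebra_on V := {bilinear V -> V -> V}.

Definition isotopic (K : fieldType) (V V' : lmodType K)
    (A : algebra_on V) (A' : algebra_on V') : Prop :=
  exists f g h : {linear V -> V'},
    [/\ bijective f, bijective g, bijective h
      & forall u v : V, A' (f u) (g v) = h (A u v)].

(* The set {1, ..., n} is rendered by 'I_n; [pq_op i j = None] means that the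
   product of i and j is undefined. *)
Record partial_quasigroup (n : nat) : Type := PartialQuasigroup {
  pq_op :> 'I_n -> 'I_n -> option 'I_n;
  pq_ldiv_uniq : forall i j x x' : 'I_n,
    pq_op i x = Some j -> pq_op i x' = Some j -> x = x';
  pq_rdiv_uniq : forall i j y y' : 'I_n,
    pq_op y i = Some j -> pq_op y' i = Some j -> y = y' }.

Section PartialQuasigroupRing.
Variables (K : fieldType) (n : nat) (Q : partial_quasigroup n).

Definition pq_basis (i : 'I_n) : 'rV[K]_n := delta_mx 0 i.

Definition pq_basis_mul (i j : 'I_n) : 'rV[K]_n :=
  if Q i j is Some k then pq_basis k else 0.

Definition pq_mul (u v : 'rV[K]_n) : 'rV[K]_n :=
  \sum_(i < n) \sum_(j < n) (u 0 i * v 0 j) *: pq_basis_mul i j.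

Lemma pq_mul_bilinear : bilinear_for *:%R *:%R pq_mul.
Proof.
split=> [v a u u'|u a v v'] /=; rewrite /pq_mul scaler_sumr -big_split /=;
  apply: eq_bigr => i _; rewrite scaler_sumr -big_split /=;
  apply: eq_bigr => j _; rewrite !mxE scalerA -scalerDl; congr (_ *: _).
  by rewrite mulrDl mulrA.
by rewrite mulrDr mulrCA.
Qed.

HB.instance Definition _ :=
  bilinear_isBilinear.Build K _ _ _ _ _ pq_mul pq_mul_bilinear.

Definition pq_ring : algebra_on 'rV[K]_n := pq_mul.

Lemma pq_ring_basis (i j : 'I_n) :
  pq_ring (pq_basis i) (pq_basis j) = pq_basis_mul i j.
Proof.
rewrite /= /pq_mul (bigD1 i) //= (bigD1 j) //= !mxE !eqxx mulr1 scale1r.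
rewrite big1 ?addr0 => [|k /negPf nkj]; last first.
  by rewrite !mxE nkj andbF mulr0 scale0r.
rewrite big1 ?addr0 // => k /negPf nki; apply: big1 => l _.
by rewrite !mxE nki andbF mul0r scale0r.
Qed.

End PartialQuasigroupRing.

Definition pq_rings (n : nat) (K : fieldType) : set (algebra_on 'rV[K]_n) :=
  range (@pq_ring K n).
Arguments pq_rings : clear implicits.

Definition isotopism_class (K : fieldType) (V : lmodType K)
    (P : set (algebra_on V)) (A : algebra_on V) : set (algebra_on V) :=
  [set B | P B /\ isotopic A B].

Definition isotopism_classes (K : fieldType) (V : lmodType K)
    (P : set (algebra_on V)) : set (set (algebra_on V)) :=
  [set isotopism_class P A | A in P].

(* Main.v *)
From HB Require Import structures.
Require Import Defs.
From mathcomp Require Import all_boot all_order all_algebra.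
From mathcomp Require Import fingroup perm.
From mathcomp Require Import sesquilinear ring.
From mathcomp Require Import boolp classical_sets functions cardinality.

Set Implicit Arguments.
Unset Strict Implicit.
Unset Printing Implicit Defensive.

Import GRing.Theory.

(** Permuting rows, columns and symbols of a partial Latin square is an
    isotopism of the associated rings ([isotopic_pq_ring]).  Up to these moves
    there are eight partial Latin squares of order two:
<<
      . .    1 .    1 2    1 .    1 .    1 .    1 2    1 2
      . .    . .    . .    2 .    . 1    . 2    2 .    2 1
     zero   point   row    col    dot   split   dual  cyclic
>>
    The last three are [K * K], the dual numbers [K[x]/(x^2)] and the group
    algebra [K[x]/(x^2 - 1)] of the group of order two.  The polynomial
    [x^2 - 1] has two simple roots when [2 != 0] and is [(x - 1)^2] otherwise,
    so the eighth ring is isomorphic to the sixth or to the seventh, depending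
    on the characteristic: in every case at most seven classes remain
    ([representatives_complete]).

    These seven are pairwise non-isotopic because they differ in properties
    that refer only to zero, nonzero and attained values of the product, hence
    are carried along by linear bijections ([isotopic_invariants]): whether the
    product vanishes, whether some nonzero element kills everything from the
    left or from the right, whether every element is a product, and whether
    zero divisors can be crossed, that is, [u v = u' v' = 0] with both [u v']
    and [u' v] nonzero.  The last property separates [K * K], where the two
    orthogonal idempotents of the basis do it, from the dual numbers, where all
    zero divisors lie on a single line whose elements multiply to zero.  The properties are packed
    into a natural number [isotopism_code], which takes the values 0, ..., 6 on
    the seven representatives ([code_representatives]); this gives the bijection
    between classes and the first seven natural numbers. *)

(** * Isotopism as an equivalence relation *)

Section Isotopism.
Local Open Scope ring_scope.
Local Open Scope classical_set_scope.

Variable K : fieldType.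

Lemma isotopic_refl (V : lmodType K) (A : algebra_on V) : isotopic A A.
Proof. by exists idfun, idfun, idfun; split=> //; exists idfun. Qed.

Lemma linear_inverse (V V' : lmodType K) (f : {linear V -> V'}) :
  bijective f -> exists f' : {linear V' -> V}, cancel f f' /\ cancel f' f.
Proof.
case=> f' fK f'K.
pose L := GRing.isLinear.Build K V' V _ f' (can2_linear fK f'K).
by exists (HB.pack_for {linear V' -> V} f' L).
Qed.

Lemma isotopic_sym (V V' : lmodType K)
    (A : algebra_on V) (A' : algebra_on V') : isotopic A A' -> isotopic A' A.
Proof.
move=> [f [g [h [/linear_inverse[f' [fK f'K]] /linear_inverse[g' [gK g'K]]]]]].
move=> /linear_inverse[h' [hK h'K]] fgh.
exists f', g', h'; split; first by exists f.
- by exists g.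
- by exists h.
by move=> u v; rewrite -{2}(f'K u) -{2}(g'K v) fgh hK.
Qed.

Lemma isotopic_trans (V1 V2 V3 : lmodType K) (A1 : algebra_on V1)
    (A2 : algebra_on V2) (A3 : algebra_on V3) :
  isotopic A1 A2 -> isotopic A2 A3 -> isotopic A1 A3.
Proof.
move=> [f [g [h [bf bg bh fgh]]]] [f' [g' [h' [bf' bg' bh' fgh']]]].
exists (f' \o f), (g' \o g), (h' \o h); split; try exact: bij_comp.
by move=> u v /=; rewrite fgh' fgh.
Qed.

Variable V : lmodType K.
Implicit Types (P : set (algebra_on V)) (A B : algebra_on V).

Lemma isotopism_class_eq P A B :
  isotopic A B -> isotopism_class P A = isotopism_class P B.
Proof.
move=> AB; apply/seteqP; split=> C [PC iC]; split=> //.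
  exact: isotopic_trans (isotopic_sym AB) iC.
exact: isotopic_trans AB iC.
Qed.

Lemma isotopism_class_inj P A B :
  P A -> isotopism_class P A = isotopism_class P B -> isotopic B A.
Proof. by move=> PA /seteqP[/(_ A) [] //]; split=> //; apply: isotopic_refl. Qed.

Lemma isotopism_classes_partition P : partition (isotopism_classes P) id P.
Proof.
split.
- apply/seteqP; split=> [B [_ [A PA <-] [] //]|A PA].
  exists (isotopism_class P A); first by exists A.
  by split=> //; apply: isotopic_refl.
- move=> _ _ [A PA <-] [B PB <-] [C [[_ AC] [_ BC]]].
  by rewrite (isotopism_class_eq P AC) (isotopism_class_eq P BC).
- by move=> _ [A PA <-]; exists A; split=> //; apply: isotopic_refl.
Qed.

(** The classes are in bijection with the representatives; that distinct
    representatives have distinct classes is witnessed by the invariant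
    [code]. *)
Lemma card_isotopism_classes P (rep : nat -> algebra_on V)
    (code : algebra_on V -> nat) (n : nat) :
    (forall k, (k < n)%N -> P (rep k)) ->
    (forall A, P A -> exists2 k, (k < n)%N & isotopic A (rep k)) ->
    (forall A B, isotopic A B -> code A = code B) ->
    (forall k, (k < n)%N -> code (rep k) = k) ->
  (isotopism_classes P #= `I_n)%card.
Proof.
move=> Prep repP codeP codeK.
have -> : isotopism_classes P = [set isotopism_class P (rep k) | k in `I_n].
  apply/seteqP; split=> [_ [A PA <-]|_ [k kn <-]]; last first.
    by exists (rep k) => //; apply: Prep.
  have [k kn Ak] := repP A PA.
  by exists k => //; rewrite (isotopism_class_eq P Ak).
apply: inj_card_eq => i j; rewrite !inE /= => ilt jlt eq_ij.
have /codeP := isotopism_class_inj (Prep i ilt) eq_ij.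
by rewrite !codeK.
Qed.

End Isotopism.

(** * Invariants of isotopism *)

Section Invariants.
Local Open Scope ring_scope.

Variable K : fieldType.

Section Definitions.
Variables (V : lmodType K) (A : algebra_on V).

Definition null_product := forall u v, A u v = 0.
Definition left_degenerate := exists2 u, u != 0 & forall v, A u v = 0.
Definition right_degenerate := exists2 v, v != 0 & forall u, A u v = 0.
Definition onto_product := forall w, exists u v, A u v = w.

(** The condition forces all four vectors to be nonzero. *)
Definition crossed_zero_divisors := exists u v u' v',
  [/\ A u v = 0, A u' v' = 0, A u v' != 0 & A u' v != 0].

(** The nesting makes each property matter only where it separates
    representatives, so that each code below rests on few facts. *)
Definition isotopism_code : nat :=
  if `[< left_degenerate >] then
    if `[< right_degenerate >] then if `[< null_product >] then 0 else 1
    else 2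
  else if `[< right_degenerate >] then 3
  else if ~~ `[< onto_product >] then 4
  else if `[< crossed_zero_divisors >] then 5
  else 6.

End Definitions.

Variables V V' : lmodType K.

Lemma bij_linear_neq0 (f : {linear V -> V'}) :
  bijective f -> forall u, u != 0 -> f u != 0.
Proof.
move=> /bij_inj fI u; apply: contraNneq => fu0.
by apply/eqP/fI; rewrite fu0 linear0.
Qed.

(** In each property [u] and [v] occur only as left and right factors, and
    products are compared only with zero or with an arbitrary vector, so [f],
    [g] and [h] may act independently.  One direction is enough, isotopism
    being symmetric. *)
Lemma isotopic_invariants (A : algebra_on V) (A' : algebra_on V') :
  isotopic A A' ->
  [/\ null_product A -> null_product A',
      left_degenerate A -> left_degenerate A',
      right_degenerate A -> right_degenerate A',
      onto_product A -> onto_product A'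
    & crossed_zero_divisors A -> crossed_zero_divisors A'].
Proof.
move=> [f [g [h [bf bg bh fgh]]]].
have f0 := bij_linear_neq0 bf; have g0 := bij_linear_neq0 bg.
have h0 := bij_linear_neq0 bh.
have [f' fK f'K] := bf; have [g' gK g'K] := bg; have [h' hK h'K] := bh.
split.
- by move=> A0 u v; rewrite -(f'K u) -(g'K v) fgh A0 linear0.
- move=> [u u0 Au]; exists (f u); first exact: f0.
  by move=> v; rewrite -(g'K v) fgh Au linear0.
- move=> [v v0 Av]; exists (g v); first exact: g0.
  by move=> u; rewrite -(f'K u) fgh Av linear0.
- move=> onA w; have [u [v Auv]] := onA (h' w).
  by exists (f u), (g v); rewrite fgh Auv h'K.
- move=> [u [v [u' [v' [uv u'v' uv' u'v]]]]].
  exists (f u), (g v), (f u'), (g v').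
  by split; rewrite ?fgh ?uv ?u'v' ?linear0 //; auto.
Qed.

End Invariants.

Lemma isotopism_code_invariant (K : fieldType) (V V' : lmodType K)
    (A : algebra_on V) (A' : algebra_on V') :
  isotopic A A' -> isotopism_code A = isotopism_code A'.
Proof.
move=> AA'.
have [z l r o c] := isotopic_invariants AA'.
have [z' l' r' o' c'] := isotopic_invariants (isotopic_sym AA').
rewrite /isotopism_code (asbool_equiv_eq (conj z z')).
rewrite (asbool_equiv_eq (conj l l')) (asbool_equiv_eq (conj r r')).
by rewrite (asbool_equiv_eq (conj o o')) (asbool_equiv_eq (conj c c')).
Qed.

(** * Isotopisms of partial quasigroup rings *)

Section PartialQuasigroupIsotopism.
Local Open Scope ring_scope.

Variables (K : fieldType) (n : nat).
Implicit Type Q : partial_quasigroup n.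

Lemma pq_ring_coord Q (u v : 'rV[K]_n) (k : 'I_n) :
  pq_ring K Q u v 0 k =
    \sum_i \sum_j u 0 i * v 0 j * (Q i j == Some k)%:R.
Proof.
rewrite /= /pq_mul summxE; apply: eq_bigr => i _.
rewrite summxE; apply: eq_bigr => j _; rewrite mxE; congr (_ * _).
rewrite /pq_basis_mul; case: (Q i j) => [l|]; last by rewrite mxE.
by rewrite mxE eqxx (inj_eq Some_inj) eq_sym.
Qed.

Lemma isotopic_mx (A A' : algebra_on 'rV[K]_n) (M N P : 'M[K]_n) :
    M \in unitmx -> N \in unitmx -> P \in unitmx ->
    (forall u v, A' (u *m M) (v *m N) = A u v *m P) ->
  isotopic A A'.
Proof.
have bij (X : 'M[K]_n) : X \in unitmx -> bijective (mulmxr X : 'rV_n -> 'rV_n).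
  by move=> uX; exists (mulmxr (invmx X)) => u /=; rewrite ?mulmxK ?mulmxKV.
move=> uM uN uP MNP; exists (mulmxr M), (mulmxr N), (mulmxr P).
by split; try exact: bij.
Qed.

(** An isotopism of partial quasigroups permutes the basis in each of the
    three slots, which linearly is the action of permutation matrices. *)
Lemma isotopic_pq_ring (Q Q' : partial_quasigroup n) (s t r : 'S_n) :
    (forall i j, Q' (s i) (t j) = omap r (Q i j)) ->
  isotopic (pq_ring K Q) (pq_ring K Q').
Proof.
move=> QQ'; apply: (@isotopic_mx _ _ (perm_mx s) (perm_mx t) (perm_mx r));
  try exact: unitmx_perm.
move=> u v; rewrite -[s]invgK -[t]invgK -[r]invgK -!col_permE.
apply/rowP => k; rewrite [RHS]mxE !pq_ring_coord.
rewrite (reindex_inj (@perm_inj _ s)) /=; apply: eq_bigr => i _.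
rewrite (reindex_inj (@perm_inj _ t)) /=; apply: eq_bigr => j _.
rewrite !mxE !permK QQ'; congr (_ * _%:R).
case: (Q i j) => //= l; rewrite !(inj_eq Some_inj).
by rewrite -(inj_eq (@perm_inj _ r^-1)) permK.
Qed.

End PartialQuasigroupIsotopism.

(** * Partial Latin squares of order two *)

Section OrderTwo.

Definition square (a b c d : option 'I_2) (i j : 'I_2) : option 'I_2 :=
  if i == ord0 then if j == ord0 then a else b
  else if j == ord0 then c else d.

(** [x] tests that the first cell is filled. *)
Definition clash (x y : option 'I_2) : bool := x && (x == y).

Definition latin (a b c d : option 'I_2) : bool :=
  ~~ [|| clash a b, clash c d, clash a c | clash b d].

Lemma ord2P (i : 'I_2) : i = ord0 \/ i = ord_max.
Proof. by case: i => [[|[|//]] ?]; [left|right]; apply: val_inj. Qed.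

Lemma square_ldiv a b c d : latin a b c d -> forall i j x x' : 'I_2,
  square a b c d i x = Some j -> square a b c d i x' = Some j -> x = x'.
Proof.
rewrite /latin !negb_or => /and4P[ab cd _ _] i j x x'.
case: (ord2P i) => ->; case: (ord2P x) => ->; case: (ord2P x') => -> //;
  rewrite /square /= => e e'; move: ab cd;
  by rewrite ?e ?e' /clash /= ?eqxx ?andbF.
Qed.

Lemma square_rdiv a b c d : latin a b c d -> forall i j y y' : 'I_2,
  square a b c d y i = Some j -> square a b c d y' i = Some j -> y = y'.
Proof.
rewrite /latin !negb_or => /and4P[_ _ ac bd] i j x x'.
case: (ord2P i) => ->; case: (ord2P x) => ->; case: (ord2P x') => -> //;
  rewrite /square /= => e e'; move: ac bd;
  by rewrite ?e ?e' /clash /= ?eqxx ?andbF.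
Qed.

Definition square_pq a b c d (L : latin a b c d) : partial_quasigroup 2 :=
  PartialQuasigroup (square_ldiv L) (square_rdiv L).

Lemma latin_pq (Q : partial_quasigroup 2) :
  latin (Q ord0 ord0) (Q ord0 ord_max) (Q ord_max ord0) (Q ord_max ord_max).
Proof.
have cl i j i' j' : clash (Q i j) (Q i' j') ->
    exists k, Q i j = Some k /\ Q i' j' = Some k.
  by case/andP; case: (Q i j) => // k _ /eqP <-; exists k.
apply/negP; case/or4P=> /cl[k [e e']].
- by have := pq_ldiv_uniq e e'.
- by have := pq_ldiv_uniq e e'.
- by have := pq_rdiv_uniq e e'.
- by have := pq_rdiv_uniq e e'.
Qed.

Lemma square_pqE (Q : partial_quasigroup 2) (i j : 'I_2) :
  Q i j = square (Q ord0 ord0) (Q ord0 ord_max) (Q ord_max ord0)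
                 (Q ord_max ord_max) i j.
Proof. by case: (ord2P i) => ->; case: (ord2P j) => ->. Qed.

Definition o1 : option 'I_2 := Some ord0.
Definition o2 : option 'I_2 := Some ord_max.

Definition zero_pq := @square_pq None None None None isT.
Definition point_pq := @square_pq o1 None None None isT.
Definition row_pq := @square_pq o1 o2 None None isT.
Definition col_pq := @square_pq o1 None o2 None isT.
Definition dot_pq := @square_pq o1 None None o1 isT.
Definition split_pq := @square_pq o1 None None o2 isT.
Definition dual_pq := @square_pq o1 o2 o2 None isT.
Definition cyclic_pq := @square_pq o1 o2 o2 o1 isT.

(** Listed in the order of their codes. *)
Definition representatives : seq (partial_quasigroup 2) :=
  [:: zero_pq; point_pq; row_pq; col_pq; dot_pq; split_pq; dual_pq].

(** Coding the permutations of two points by booleans lets the search for an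
    isotopism run by computation. *)
Definition flip (b : bool) (i : 'I_2) : 'I_2 := if b then rev_ord i else i.

Lemma flip_inj b : injective (flip b).
Proof. by case: b => //; apply: rev_ord_inj. Qed.

(** Quantifiers over explicit lists, unlike those over finite types, are
    evaluated by computation. *)
Definition flip_isotopic (T T' : 'I_2 -> 'I_2 -> option 'I_2) : bool :=
  let B := [:: false; true] in let I := [:: ord0; ord_max : 'I_2] in
  has (fun s => has (fun t => has (fun r =>
    all (fun i => all (fun j =>
      T' (flip s i) (flip t j) == omap (flip r) (T i j)) I) I) B) B) B.

Lemma flip_isotopicP (K : fieldType) (Q Q' : partial_quasigroup 2) :
  flip_isotopic Q Q' -> isotopic (pq_ring K Q) (pq_ring K Q').
Proof.
case/hasP=> s _ /hasP[t _ /hasP[r _ /allP str]].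
apply: (@isotopic_pq_ring _ _ _ _ (perm (@flip_inj s)) (perm (@flip_inj t))
          (perm (@flip_inj r))) => i j.
have I2 (k : 'I_2) : k \in [:: ord0; ord_max].
  by rewrite !inE; case: (ord2P k) => ->.
rewrite !permE (eqP (allP (str i (I2 i)) j (I2 j))).
by case: (Q i j) => //= k; rewrite permE.
Qed.

(** Only 81 arrays and 8 triples of permutations are involved, so the
    normal forms are found by exhaustive search. *)
Lemma latin_flip_isotopic a b c d : latin a b c d ->
  has (fun Q : partial_quasigroup 2 => flip_isotopic (square a b c d) Q)
    (rcons representatives cyclic_pq).
Proof.
have inC (x : option 'I_2) : x \in [:: None; o1; o2].
  by case: x => // k; case: (ord2P k) => ->.
pose C := [:: None; o1; o2].
have /allP check : all (fun a => all (fun b => all (fun c => all (fun d =>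
    latin a b c d ==>
    has (fun Q : partial_quasigroup 2 => flip_isotopic (square a b c d) Q)
      (rcons representatives cyclic_pq)) C) C) C) C.
  by vm_compute.
have := allP (allP (allP (check a (inC a)) b (inC b)) c (inC c)) d (inC d).
by move/implyP.
Qed.

End OrderTwo.

(** * The products of the eight normal forms *)

Section Products.
Local Open Scope ring_scope.

Variable K : fieldType.
Implicit Types x y : K.

Definition row2 x y : 'rV[K]_2 := \row_(k < 2) if k == ord0 then x else y.

Lemma row2_ind (P : 'rV[K]_2 -> Prop) :
  (forall x y, P (row2 x y)) -> forall u, P u.
Proof.
move=> P2 u; suff -> : u = row2 (u 0 ord0) (u 0 ord_max) by [].
by apply/rowP => k; rewrite mxE; case: (ord2P k) => ->.
Qed.

Lemma row2_inj x y x' y' : row2 x y = row2 x' y' -> x = x' /\ y = y'.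
Proof.
by move=> /rowP e; have:= e ord0; have:= e ord_max; rewrite !mxE /=.
Qed.

Lemma row2_0 : row2 0 0 = 0.
Proof. by apply/rowP => k; rewrite !mxE if_same. Qed.

Lemma row2_eq0 x y : (row2 x y == 0) = (x == 0) && (y == 0).
Proof.
rewrite -row2_0; apply/eqP/andP => [/row2_inj[-> ->]|[/eqP-> /eqP->]] //.
Qed.

Lemma square_mulE a b c d (L : latin a b c d) x1 x2 y1 y2 :
  pq_ring K (square_pq L) (row2 x1 x2) (row2 y1 y2) =
    let coord k := x1 * y1 * (a == Some k)%:R + x1 * y2 * (b == Some k)%:R
                 + x2 * y1 * (c == Some k)%:R + x2 * y2 * (d == Some k)%:R in
    row2 (coord ord0) (coord ord_max).
Proof.
apply/rowP => k; rewrite pq_ring_coord !big_ord_recl !big_ord0 !mxE /=.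
by case: (ord2P k) => ->; rewrite /square /= !addr0 addrA.
Qed.

Let mulE := (square_mulE, mulr1, mulr0, addr0, add0r).

Lemma zero_mulE x1 x2 y1 y2 :
  pq_ring K zero_pq (row2 x1 x2) (row2 y1 y2) = 0.
Proof. by rewrite !mulE /= !mulE row2_0. Qed.

Lemma point_mulE x1 x2 y1 y2 :
  pq_ring K point_pq (row2 x1 x2) (row2 y1 y2) = row2 (x1 * y1) 0.
Proof. by rewrite !mulE /= !mulE. Qed.

Lemma row_mulE x1 x2 y1 y2 :
  pq_ring K row_pq (row2 x1 x2) (row2 y1 y2) = row2 (x1 * y1) (x1 * y2).
Proof. by rewrite !mulE /= !mulE. Qed.

Lemma col_mulE x1 x2 y1 y2 :
  pq_ring K col_pq (row2 x1 x2) (row2 y1 y2) = row2 (x1 * y1) (x2 * y1).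
Proof. by rewrite !mulE /= !mulE. Qed.

Lemma dot_mulE x1 x2 y1 y2 :
  pq_ring K dot_pq (row2 x1 x2) (row2 y1 y2) = row2 (x1 * y1 + x2 * y2) 0.
Proof. by rewrite !mulE /= !mulE. Qed.

Lemma split_mulE x1 x2 y1 y2 :
  pq_ring K split_pq (row2 x1 x2) (row2 y1 y2) = row2 (x1 * y1) (x2 * y2).
Proof. by rewrite !mulE /= !mulE. Qed.

Lemma dual_mulE x1 x2 y1 y2 :
  pq_ring K dual_pq (row2 x1 x2) (row2 y1 y2) =
    row2 (x1 * y1) (x1 * y2 + x2 * y1).
Proof. by rewrite !mulE /= !mulE. Qed.

Lemma cyclic_mulE x1 x2 y1 y2 :
  pq_ring K cyclic_pq (row2 x1 x2) (row2 y1 y2) =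
    row2 (x1 * y1 + x2 * y2) (x1 * y2 + x2 * y1).
Proof. by rewrite !mulE /= !mulE. Qed.

(** * The codes of the seven representatives *)

(** One-sided units rule out degeneracy at once; they exist in the row, column,
    split and dual rings. *)
Lemma right_unit_faithful (V : lmodType K) (A : algebra_on V) e :
  (forall u, A u e = u) -> ~ left_degenerate A.
Proof. by move=> Ae [u /eqP u0 Au]; apply: u0; rewrite -(Ae u) Au. Qed.

Lemma left_unit_faithful (V : lmodType K) (A : algebra_on V) e :
  (forall u, A e u = u) -> ~ right_degenerate A.
Proof. by move=> Ae [u /eqP u0 Au]; apply: u0; rewrite -(Ae u) Au. Qed.

Lemma row2_10_neq0 : row2 1 0 != 0.
Proof. by rewrite row2_eq0 oner_eq0. Qed.

Lemma row2_01_neq0 : row2 0 1 != 0.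
Proof. by rewrite row2_eq0 oner_eq0 andbF. Qed.

Lemma code_zero : isotopism_code (pq_ring K zero_pq) = 0%N.
Proof.
have A0 : null_product (pq_ring K zero_pq).
  by elim/row2_ind=> ? ?; elim/row2_ind=> ? ?; rewrite zero_mulE.
have e0 := row2_10_neq0.
by rewrite /isotopism_code !asboolT //; exists (row2 1 0).
Qed.

Lemma code_point : isotopism_code (pq_ring K point_pq) = 1%N.
Proof.
have e0 := row2_01_neq0.
rewrite /isotopism_code asboolT; last first.
  exists (row2 0 1) => //; elim/row2_ind=> ? ?.
  by rewrite point_mulE mul0r row2_0.
rewrite asboolT; last first.
  exists (row2 0 1) => //; elim/row2_ind=> ? ?.
  by rewrite point_mulE mulr0 row2_0.
rewrite asboolF // => /(_ (row2 1 0) (row2 1 0)) /eqP.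
by rewrite point_mulE mulr1 (negPf row2_10_neq0).
Qed.

Lemma code_row : isotopism_code (pq_ring K row_pq) = 2.
Proof.
rewrite /isotopism_code asboolT; last first.
  exists (row2 0 1); first exact: row2_01_neq0.
  by elim/row2_ind=> ? ?; rewrite row_mulE !mul0r row2_0.
rewrite asboolF //; apply: (@left_unit_faithful _ _ (row2 1 0)).
by elim/row2_ind=> ? ?; rewrite row_mulE !mul1r.
Qed.

Lemma code_col : isotopism_code (pq_ring K col_pq) = 3.
Proof.
rewrite /isotopism_code asboolF; last first.
  apply: (@right_unit_faithful _ _ (row2 1 0)).
  by elim/row2_ind=> ? ?; rewrite col_mulE !mulr1.
rewrite asboolT //; exists (row2 0 1); first exact: row2_01_neq0.
by elim/row2_ind=> ? ?; rewrite col_mulE !mulr0 row2_0.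
Qed.

Lemma code_dot : isotopism_code (pq_ring K dot_pq) = 4.
Proof.
rewrite /isotopism_code asboolF; last first.
  case; elim/row2_ind=> x y /eqP u0 uA; apply: u0.
  have := uA (row2 1 0); have := uA (row2 0 1).
  rewrite !dot_mulE !(mulr0, mulr1, add0r, addr0) -row2_0.
  by move=> /row2_inj[-> _] /row2_inj[-> _].
rewrite asboolF; last first.
  case; elim/row2_ind=> x y /eqP u0 uA; apply: u0.
  have := uA (row2 1 0); have := uA (row2 0 1).
  rewrite !dot_mulE !(mul0r, mul1r, add0r, addr0) -row2_0.
  by move=> /row2_inj[-> _] /row2_inj[-> _].
(* All products are multiples of the first basis vector. *)
rewrite asboolF // => /(_ (row2 0 1)) [].
elim/row2_ind=> x1 x2 []; elim/row2_ind=> y1 y2.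
by rewrite dot_mulE => /row2_inj[_ /esym/eqP]; rewrite oner_eq0.
Qed.

(** With a two-sided unit both factors are faithful and [w = w e] is a product,
    so only the crossing of zero divisors remains to be decided. *)
Lemma unital_code (A : algebra_on 'rV[K]_2) e :
    (forall u, A e u = u) -> (forall u, A u e = u) ->
  isotopism_code A = if `[< crossed_zero_divisors A >] then 5 else 6.
Proof.
move=> eA Ae; rewrite /isotopism_code.
rewrite asboolF; last exact: right_unit_faithful Ae.
rewrite asboolF; last exact: left_unit_faithful eA.
by rewrite asboolT // => w; exists w, e.
Qed.

Lemma code_split : isotopism_code (pq_ring K split_pq) = 5.
Proof.
rewrite (@unital_code _ (row2 1 1)) ?asboolT //; last first.
- by elim/row2_ind=> ? ?; rewrite split_mulE !mulr1.
- by elim/row2_ind=> ? ?; rewrite split_mulE !mul1r.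
(* The two orthogonal idempotents, in both orders. *)
exists (row2 1 0), (row2 0 1), (row2 0 1), (row2 1 0).
rewrite !split_mulE !mulr0 !mul0r mulr1 row2_0.
by split; rewrite // (row2_10_neq0, row2_01_neq0).
Qed.

Lemma code_dual : isotopism_code (pq_ring K dual_pq) = 6.
Proof.
rewrite (@unital_code _ (row2 1 0)); last first.
- by elim/row2_ind=> ? ?; rewrite dual_mulE !mulr1 mulr0 add0r.
- by elim/row2_ind=> ? ?; rewrite dual_mulE !mul1r mul0r addr0.
rewrite asboolF // => -[]; elim/row2_ind=> x1 x2.
move=> []; elim/row2_ind=> y1 y2 []; elim/row2_ind=> x1' x2'.
move=> []; elim/row2_ind=> y1' y2'.
rewrite !dual_mulE -row2_0.
move=> -[/row2_inj[xy /eqP xy2] /row2_inj[xy' /eqP xy2'] uv' u'v].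
(* [u] and [v'] are on the line spanned by the nilpotent basis vector, since
   otherwise [v] or [u'] would vanish, against [u' v != 0]; so [u v' = 0]. *)
have x10 : x1 = 0.
  apply/eqP/contraT => x1n0.
  have y10 : y1 = 0 by apply/eqP; move/eqP: xy; rewrite mulf_eq0 (negPf x1n0).
  have y20 : y2 = 0.
    by apply/eqP; move: xy2; rewrite y10 mulr0 addr0 mulf_eq0 (negPf x1n0).
  by move: u'v; rewrite y10 y20 !mulr0 addr0 eqxx.
have y10' : y1' = 0.
  apply/eqP/contraT => y1n0.
  have x10' : x1' = 0.
    by apply/eqP; move/eqP: xy'; rewrite mulf_eq0 (negPf y1n0) orbF.
  have x20' : x2' = 0.
    apply/eqP; move: xy2'.
    by rewrite x10' mul0r add0r mulf_eq0 (negPf y1n0) orbF.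
  by move: u'v; rewrite x10' x20' !mul0r addr0 eqxx.
by move: uv'; rewrite x10 y10' !(mul0r, mulr0) addr0 eqxx.
Qed.

(** * The group algebra of the group of order two *)

Definition mx2 a b c d : 'M[K]_2 :=
  \matrix_(i < 2) if i == ord0 then row2 a b else row2 c d.

Lemma row2_mulmx x y a b c d :
  row2 x y *m mx2 a b c d = row2 (x * a + y * c) (x * b + y * d).
Proof.
apply/rowP => k; rewrite mxE !big_ord_recl big_ord0 !mxE /= addr0.
by case: ifP.
Qed.

Lemma mx2_unit a b c d : a * d - b * c != 0 -> mx2 a b c d \in unitmx.
Proof.
move=> D0; rewrite unitmxE unitfE; apply: contraNneq D0 => <-.
rewrite (expand_det_row _ ord0) !big_ord_recl big_ord0 /cofactor.
rewrite !det_mx11 !mxE /=.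
by apply/eqP; rewrite /bump /= expr0 expr1; ring.
Qed.

(** The isomorphism evaluates [x1 + x2 X] at the two roots 1 and -1 of
    [X^2 - 1]. *)
Lemma cyclic_split :
  (2%:R : K) != 0 -> isotopic (pq_ring K cyclic_pq) (pq_ring K split_pq).
Proof.
move=> two_neq0.
have uM : mx2 1 1 1 (-1) \in unitmx.
  by apply: mx2_unit; rewrite mulrN !mulr1 -opprD oppr_eq0.
apply: (isotopic_mx uM uM uM).
elim/row2_ind=> x1 x2; elim/row2_ind=> y1 y2.
rewrite cyclic_mulE !row2_mulmx split_mulE; congr row2; ring.
Qed.

(** In characteristic two, [X^2 - 1 = (X - 1)^2], and the isomorphism rewrites
    [x1 + x2 X] as [(x1 + x2) + x2 (X - 1)]. *)
Lemma cyclic_dual :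
  (2%:R : K) = 0 -> isotopic (pq_ring K cyclic_pq) (pq_ring K dual_pq).
Proof.
move=> two_eq0.
have uM : mx2 1 0 1 1 \in unitmx.
  by apply: mx2_unit; rewrite mulr1 mul0r subr0 oner_eq0.
apply: (isotopic_mx uM uM uM).
elim/row2_ind=> x1 x2; elim/row2_ind=> y1 y2.
rewrite cyclic_mulE !row2_mulmx dual_mulE; congr row2; first by ring.
(* The two sides differ by a multiple of 2. *)
transitivity (x1 * y2 + x2 * y1 + 2%:R * (x2 * y2)); first by ring.
by rewrite two_eq0; ring.
Qed.

(** * The seven classes *)

Lemma representatives_complete (Q : partial_quasigroup 2) :
  exists2 k, (k < 7)%N &
    isotopic (pq_ring K Q) (pq_ring K (nth zero_pq representatives k)).
Proof.
have: exists2 k, (k < 8)%N & isotopic (pq_ring K Q)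
    (pq_ring K (nth zero_pq (rcons representatives cyclic_pq) k)).
  pose Qs := square_pq (latin_pq Q).
  have QQs : isotopic (pq_ring K Q) (pq_ring K Qs).
    apply: (@isotopic_pq_ring _ _ _ _ 1 1 1) => i j.
    by rewrite !perm1 -[Qs i j]square_pqE; case: (Q i j) => //= k; rewrite perm1.
  have /(has_nthP zero_pq)[k k8 /(flip_isotopicP K)] :=
    latin_flip_isotopic (latin_pq Q).
  by exists k => //; apply: isotopic_trans QQs _.
case=> k; rewrite ltnS leq_eqVlt => /predU1P[->|k7] Qk; last first.
  by exists k; last by move: Qk; rewrite nth_rcons k7.
have [two0|two_n0] := eqVneq (2%:R : K) 0.
  (* Positions 5 and 6 are those of the split and dual rings. *)
  by exists 6; last exact: isotopic_trans Qk (cyclic_dual two0).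
by exists 5; last exact: isotopic_trans Qk (cyclic_split two_n0).
Qed.

Lemma code_representatives k : (k < 7)%N ->
  isotopism_code (pq_ring K (nth zero_pq representatives k)) = k.
Proof.
case: k => [|[|[|[|[|[|[|//]]]]]]] _ /=; [exact: code_zero|exact: code_point|
  exact: code_row|exact: code_col|exact: code_dot|exact: code_split|
  exact: code_dual].
Qed.

End Products.

Local Open Scope classical_set_scope.
Local Open Scope card_scope.

Theorem theorem4 (K : finFieldType) :
  partition (isotopism_classes (pq_rings 2 K)) id (pq_rings 2 K) /\
  isotopism_classes (pq_rings 2 K) #= `I_7.
Proof.
split; first exact: isotopism_classes_partition.
apply: (@card_isotopism_classes _ _ _
  (fun k => pq_ring K (nth zero_pq representatives k)) (@isotopism_code K _)).
- by move=> k _; exists (nth zero_pq representatives k).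
- by move=> _ [Q _ <-]; apply: representatives_complete.
- by move=> A B; apply: isotopism_code_invariant.
- exact: code_representatives.
Qed.
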